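(* Let $n_0\in\mathbb{Z}_{>0}$ and $a\in\mathbb{Z}$, and put $n_{i+1}:=n_i/\gcd(n_i,1+a)$ for every $i\in\mathbb{Z}_{\ge0}$. Let $l$ be the minimal non-negative integer satisfying $n_l=n_{l+1}$. Then the Alexander quandle $\mathbb{Z}[t^{\pm1}]/(n_0,t+a)$ is decomposed into $N$ maximal connected subquandles, where $N=\prod_{i=0}^{l-1}\gcd(n_i,1+a)$ (that is, its maximal connected subquandle decomposition consists of exactly $N$ maximal connected subquandles), and every maximal connected subquandle of $\mathbb{Z}[t^{\pm1}]/(n_0,t+a)$ is isomorphic to the Alexander quandle $\mathbb{Z}[t^{\pm1}]/(n_l,t+a)$.
   Context: A quandle is a non-empty set $X$ with a binary operation $*$ such that (i) $a*a=a$ for all $a$; (ii) for every $a\in X$ the map $S_a:X\to X$, $S_a(x)=x*a$, is a bijection; (iii) $(a*b)*c=(a*c)*(b*c)$ for all $a,b,c$. A quandle isomorphism is a bijection preserving $*$. A subquandle is a non-empty subset that is itself a quandle under $*$. The inner automorphism group $\mathrm{Inn}(X)$ is the group of bijections of $X$ generated by $\{S_a\mid a\in X\}$. A quandle $X$ is connected if $\mathrm{Inn}(X)$ acts transitively on $X$. A connected subquandle of $X$ is a subquandle which is connected as a quandle in its own right. A connected subquandle $A$ of $X$ is a maximal connected subquandle of $X$ if the only connected subquandle of $X$ including $A$ is $A$ itself. $X=\bigsqcup_{i\in I}A_i$ is called the maximal connected subquandle decomposition of $X$ when each $A_i$ is a maximal connected subquandle of $X$ (every quandle has exactly one such decomposition).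 For a $\mathbb{Z}[t^{\pm1}]$-module $M$, the Alexander quandle $M$ is the set $M$ with $x*y=tx+(1-t)y$. Here $(n,t+a)$ denotes the ideal of $\mathbb{Z}[t^{\pm1}]$ generated by $n$ and $t+a$. An empty product equals $1$. *)

(* Defs.v *)
From HB Require Import structures.
From mathcomp Require Import all_boot all_order all_algebra.
From mathcomp Require Import boolp classical_sets functions cardinality.

Set Implicit Arguments.
Unset Strict Implicit.
Unset Printing Implicit Defensive.

Import GRing.Theory.

Local Open Scope ring_scope.
Local Open Scope classical_set_scope.

Definition is_quandle (T : Type) (op : T -> T -> T) : Prop :=
  [/\ inhabited T,
      idempotent_op op,
      forall a, bijective (fun x => op x a)
    & left_distributive op op].

Record quandle := Quandle {
  quandle_sort :> Type;
  qop : quandle_sort -> quandle_sort -> quandle_sort;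
  quandleP : is_quandle qop
}.

Definition quandle_iso (X Y : quandle) : Prop :=
  exists2 f : X -> Y, bijective f & {morph f : x y / qop x y}.

(* Inn(X), as the set of self-maps of X lying in the group generated by the
   right translations x |-> x * a. *)
Inductive inner (X : quandle) : set (X -> X) :=
| inner_translation a : inner (fun x => qop x a)
| inner_id : inner id
| inner_comp f g : inner f -> inner g -> inner (f \o g)
| inner_inv f g : inner f -> cancel f g -> cancel g f -> inner g.

Definition connected_quandle (X : quandle) : Prop :=
  forall x y : X, exists2 f, inner f & f x = y.

Definition qclosed (X : quandle) (A : set X) : Prop :=
  forall x y, x \in A -> y \in A -> qop x y \in A.

Definition sub_qop (X : quandle) (A : set X) (clA : qclosed A) (x y : A) : A :=
  exist _ (qop (val x) (val y)) (clA _ _ (valP x) (valP y)).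

Record subquandle (X : quandle) := SubQuandle {
  subquandle_set :> set X;
  subquandle_closed : qclosed subquandle_set;
  subquandleP : is_quandle (sub_qop subquandle_closed)
}.

Definition quandle_of_sub (X : quandle) (A : subquandle X) : quandle :=
  Quandle (subquandleP A).

Definition connected_subquandle (X : quandle) (A : subquandle X) : Prop :=
  connected_quandle (quandle_of_sub A).

Definition max_connected_subquandle (X : quandle) (A : subquandle X) : Prop :=
  connected_subquandle A /\
  forall B : subquandle X, connected_subquandle B ->
    A `<=` B -> B = A :> set X.

Definition max_connected_sets (X : quandle) : set (set X) :=
  [set S | exists2 A : subquandle X,
             max_connected_subquandle A & S = A :> set X].
Arguments max_connected_sets X : clear implicits.

Definition max_connected_decomposition (X : quandle) (D : set (set X)) : Prop :=
  D `<=` max_connected_sets X /\ partition D id [set: X].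

(* Z[t, t^-1] is the subring of the field Z(t) of rational fractions formed by
   the p / t^k. *)
Definition laurent_pred : {pred {fraction {poly int}}} :=
  fun f => `[< exists (p : {poly int}) (k : nat),
                 f = FracField.tofrac p / FracField.tofrac 'X ^+ k >].

Lemma laurent_predP f :
  reflect (exists (p : {poly int}) (k : nat),
             f = FracField.tofrac p / FracField.tofrac 'X ^+ k)
          (f \in laurent_pred).
Proof. exact: asboolP. Qed.

Lemma tofracX_neq0 : FracField.tofrac ('X : {poly int}) != 0.
Proof. by rewrite tofrac_eq0 polyX_eq0. Qed.

Lemma laurent_subring_closed : subring_closed laurent_pred.
Proof.
have X0 k : FracField.tofrac ('X : {poly int}) ^+ k != 0.
  by rewrite expf_neq0 ?tofracX_neq0.
split.
- by apply/laurent_predP; exists 1, 0%N; rewrite rmorph1 expr0 divr1.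
- move=> _ _ /laurent_predP[p [k ->]] /laurent_predP[q [m ->]].
  apply/laurent_predP; exists (p * 'X^m - q * 'X^k), (k + m)%N.
  by rewrite rmorphB !rmorphM !rmorphXn /= exprD -!mulNr
    addf_div ?X0.
- move=> _ _ /laurent_predP[p [k ->]] /laurent_predP[q [m ->]].
  apply/laurent_predP; exists (p * q), (k + m)%N.
  by rewrite rmorphM /= exprD mulf_div.
Qed.

HB.instance Definition _ :=
  GRing.isSubringClosed.Build {fraction {poly int}} laurent_pred
    laurent_subring_closed.

Record laurent := Laurent {
  laurent_val : {fraction {poly int}};
  laurent_valP : laurent_val \in laurent_pred
}.

HB.instance Definition _ := [isSub for laurent_val].
HB.instance Definition _ := [Choice of laurent by <:].
HB.instance Definition _ := [SubChoice_isSubComNzRing of laurent by <:].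

Lemma laurent_t_subproof : FracField.tofrac 'X \in laurent_pred.
Proof. by apply/laurent_predP; exists 'X, 0%N; rewrite expr0 divr1. Qed.

Lemma laurent_tV_subproof : (FracField.tofrac 'X)^-1 \in laurent_pred.
Proof. by apply/laurent_predP; exists 1, 1%N; rewrite rmorph1 expr1 div1r. Qed.

Definition laurent_t : laurent := Laurent laurent_t_subproof.
Definition laurent_tV : laurent := Laurent laurent_tV_subproof.

Lemma laurent_mulVt : laurent_tV * laurent_t = 1.
Proof. by apply: val_inj; rewrite /= mulVf ?tofracX_neq0. Qed.

Definition ideal2 (R : comNzRingType) (x y : R) : {pred R} :=
  fun r => `[< exists u v : R, r = u * x + v * y >].

Lemma ideal2P (R : comNzRingType) (x y r : R) :
  reflect (exists u v : R, r = u * x + v * y) (r \in ideal2 x y).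
Proof. exact: asboolP. Qed.

Lemma ideal2_zmod_closed (R : comNzRingType) (x y : R) :
  zmod_closed (ideal2 x y).
Proof.
split; first by apply/ideal2P; exists 0, 0; rewrite !mul0r addr0.
move=> _ _ /ideal2P[u [v ->]] /ideal2P[u' [v' ->]].
by apply/ideal2P; exists (u - u'), (v - v'); rewrite !mulrBl opprD addrACA.
Qed.

HB.instance Definition _ (R : comNzRingType) (x y : R) :=
  GRing.isZmodClosed.Build R (ideal2 x y) (ideal2_zmod_closed x y).

Lemma ideal2Ml (R : comNzRingType) (x y a r : R) :
  r \in ideal2 x y -> a * r \in ideal2 x y.
Proof.
move=> /ideal2P[u [v ->]]; apply/ideal2P; exists (a * u), (a * v).
by rewrite mulrDr !mulrA.
Qed.

(* {ideal_quot I} requires 1 \notin I; the additive quotient {quot I} does not,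
   so that R / (x, y) is allowed to be trivial. *)
Definition ideal2_quot (R : comNzRingType) (x y : R) : Type :=
  Quotient.quot (ideal2 x y).

HB.instance Definition _ (R : comNzRingType) (x y : R) :=
  GRing.Zmodule.on (ideal2_quot x y).

Definition ideal2_scale (R : comNzRingType) (x y : R)
    (a : R) (q : ideal2_quot x y) : ideal2_quot x y :=
  \pi_(Quotient.quot (ideal2 x y))%qT (a * repr (q : Quotient.quot (ideal2 x y))).

Lemma ideal2_scale_pi (R : comNzRingType) (x y a r : R) :
  ideal2_scale a (\pi_(Quotient.quot (ideal2 x y))%qT r : ideal2_quot x y) =
  \pi_(Quotient.quot (ideal2 x y))%qT (a * r).
Proof.
apply/eqP; rewrite -Quotient.idealrBE -mulrBr; apply: ideal2Ml.
by rewrite Quotient.idealrBE reprK.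
Qed.

Lemma ideal2_scalerA (R : comNzRingType) (x y : R) a b (q : ideal2_quot x y) :
  ideal2_scale a (ideal2_scale b q) = ideal2_scale (a * b) q.
Proof. by rewrite ideal2_scale_pi mulrA. Qed.

Lemma ideal2_scale1r (R : comNzRingType) (x y : R) :
  left_id 1 (@ideal2_scale R x y).
Proof. by move=> q; rewrite /ideal2_scale mul1r reprK. Qed.

Lemma ideal2_scalerDr (R : comNzRingType) (x y : R) :
  right_distributive (@ideal2_scale R x y) +%R.
Proof.
move=> a; elim/(@quotW _ (Quotient.quot (ideal2 x y))) => p.
elim/(@quotW _ (Quotient.quot (ideal2 x y))) => q.
rewrite -[X in ideal2_scale a X](raddfD (\pi_(Quotient.quot (ideal2 x y)))%qT p q).
by rewrite !ideal2_scale_pi mulrDr raddfD.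
Qed.

Lemma ideal2_scalerDl (R : comNzRingType) (x y : R) (q : ideal2_quot x y) :
  {morph (@ideal2_scale R x y)^~ q : a b / a + b}.
Proof. by move=> a b; rewrite /ideal2_scale mulrDl raddfD. Qed.

HB.instance Definition _ (R : comNzRingType) (x y : R) :=
  GRing.Zmodule_isLmodule.Build R (ideal2_quot x y)
    (@ideal2_scalerA R x y) (@ideal2_scale1r R x y)
    (@ideal2_scalerDr R x y) (@ideal2_scalerDl R x y).

Definition alexander_op (M : lmodType laurent) (x y : M) : M :=
  laurent_t *: x + (1 - laurent_t) *: y.

Lemma alexander_is_quandle (M : lmodType laurent) :
  is_quandle (@alexander_op M).
Proof.
split.
- exact: (inhabits 0).
- by move=> x; rewrite /alexander_op -scalerDl addrC subrK scale1r.
- move=> y.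
  exists (fun x => laurent_tV *: (x - (1 - laurent_t) *: y)) => x;
    rewrite /alexander_op.
  + by rewrite addrK scalerA laurent_mulVt scale1r.
  + by rewrite scalerA mulrC laurent_mulVt scale1r subrK.
- move=> x y z; rewrite /alexander_op !scalerDr !scalerA.
  rewrite [RHS]addrACA -!addrA; congr (_ + _).
  rewrite [(1 - laurent_t) * laurent_t]mulrC; congr (_ + _).
  by rewrite -scalerDl -mulrDl [laurent_t + _]addrC subrK mul1r.
Qed.

Definition alexander_quandle (M : lmodType laurent) : quandle :=
  Quandle (alexander_is_quandle M).

Definition alexander_mod (m : nat) (a : int) : quandle :=
  alexander_quandle (ideal2_quot (m%:R : laurent) (laurent_t + a%:~R)).

(* Main.v *)
(* Put N = prod gcd(n_i, 1+a) and m = n_l; then n_0 = N m, where N divides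
   (1+a)^l and m is coprime to 1+a.  On M = Z[t,1/t]/(n_0, t+a) the element 1-t
   acts as 1+a.  An inner automorphism of a subquandle contained in a coset of
   (1-t)^k M preserves every coset of (1-t)^(k+1) M, so a connected subquandle
   lies in one coset of (1-t)^k M for every k, hence in one coset of N M.
   Conversely 1-t is surjective on N M, so right translations by elements of a
   coset of N M move any point of it to any other.  Hence the maximal connected
   subquandles are the cosets of N M: there are |Z/N| = N of them because a is
   invertible modulo N, and multiplication by N identifies
   Z[t,1/t]/(m, t+a) with N M. *)

Require Import Defs.
From HB Require Import structures.
From mathcomp Require Import all_boot all_order all_algebra.
From mathcomp Require Import boolp classical_sets functions cardinality.
From mathcomp Require Import ring.

Import GRing.Theory.

Local Open Scope ring_scope.
Local Open Scope classical_set_scope.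
Local Open Scope card_scope.

(** * Cosets of [s M] in an Alexander quandle and connectedness *)

(** Induction on the generation of [f]: the equivalence axioms absorb identity, composites and
    inverses, so only translations need checking. This confines orbits to classes of [E]. *)
Lemma inner_preserves (X : quandle) (E : X -> X -> Prop) :
    (forall x, E x x) -> (forall x y, E x y -> E y x) ->
    (forall x y z, E x y -> E y z -> E x z) -> (forall x a, E x (qop x a)) ->
  forall f, inner f -> forall x, E x (f x).
Proof.
move=> Er Es Et Eop f; elim=> {f} [a|//|f g _ Ef _ Eg|f g _ Ef _ gK] x /=.
- exact: Eop.
- exact: Et (Eg x) (Ef (g x)).
- by apply: Es; rewrite -{2}(gK x).
Qed.

Definition scaled_coset (M : lmodType laurent) (s : laurent) (x : M) : set M :=
  [set y | exists w, y = x + s *: w].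

Lemma scaled_coset_refl (M : lmodType laurent) s (x : M) : scaled_coset M s x x.
Proof. by exists 0; rewrite scaler0 addr0. Qed.

Lemma scaled_coset_sym (M : lmodType laurent) s (x y : M) :
  scaled_coset M s x y -> scaled_coset M s y x.
Proof. by move=> [w ->]; exists (- w); rewrite scalerN addrK. Qed.

Lemma scaled_coset_trans (M : lmodType laurent) s (x y z : M) :
  scaled_coset M s x y -> scaled_coset M s y z -> scaled_coset M s x z.
Proof. by move=> [w ->] [w' ->]; exists (w + w'); rewrite scalerDr addrA. Qed.

Lemma scaled_coset_eq (M : lmodType laurent) s (x y : M) :
  scaled_coset M s x y -> scaled_coset M s x = scaled_coset M s y.
Proof.
move=> xy; apply/seteqP; split=> z; apply: scaled_coset_trans => //.
exact: scaled_coset_sym.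
Qed.

Lemma alexander_opE (M : lmodType laurent) (x y : M) :
  alexander_op x y = x + (1 - laurent_t) *: (y - x).
Proof.
rewrite /alexander_op scalerBr addrCA addrC; congr (_ + _).
by rewrite scalerBl scale1r opprB addrCA subrr addr0.
Qed.

(** The map [w] to [x + s w] is a quandle homomorphism. Hence cosets are closed, and computations in
    a coset reduce to [M]. *)
Lemma alexander_op_affine (M : lmodType laurent) s (x u v : M) :
  alexander_op (x + s *: u) (x + s *: v) = x + s *: alexander_op u v.
Proof.
rewrite !alexander_opE opprD addrACA subrr add0r -addrA; congr (_ + _).
by rewrite -scalerBr [RHS]scalerDr !scalerA [_ * s]mulrC.
Qed.

Lemma alexander_opK (M : lmodType laurent) (y : M) :
  cancel (fun x => laurent_tV *: (x - (1 - laurent_t) *: y))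
         (fun x => alexander_op x y).
Proof.
by move=> x; rewrite /alexander_op scalerA mulrC laurent_mulVt scale1r subrK.
Qed.

Lemma alexander_op_inj (M : lmodType laurent) (y : M) :
  injective (fun x => alexander_op x y).
Proof.
by case: (alexander_is_quandle M) => _ _ /(_ y) /bij_inj.
Qed.

(** Induction on [k]: translating [u] by [v] displaces it by [(1 - t)(v - u)]. If all points of [A]
    differ by elements of [(1 - t)^k M], then orbits in [A] stay in cosets of [(1 - t)^(k+1) M], and
    [A] is a single orbit. *)
Lemma connected_sub_coset (M : lmodType laurent)
    (A : subquandle (alexander_quandle M)) (k : nat) (x y : M) :
  connected_subquandle A -> subquandle_set A x -> subquandle_set A y ->
  scaled_coset M ((1 - laurent_t) ^+ k) x y.
Proof.
move=> connA; elim: k x y => [|k IH] x y Ax Ay.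
  by exists (y - x); rewrite expr0 scale1r addrC subrK.
have [f inf fxy] := connA (exist _ x (mem_set Ax)) (exist _ y (mem_set Ay)).
have: scaled_coset M ((1 - laurent_t) ^+ k.+1) x
    (val (f (exist _ x (mem_set Ax)))).
  apply: (@inner_preserves (quandle_of_sub A)
    (fun u v => scaled_coset M ((1 - laurent_t) ^+ k.+1) (val u) (val v))
    _ _ _ _ f inf (exist _ x (mem_set Ax))).
  - by move=> u; exact: scaled_coset_refl.
  - by move=> u v; exact: scaled_coset_sym.
  - by move=> u v w; exact: scaled_coset_trans.
  - move=> u v /=.
    have [w vw] := IH _ _ (set_mem (valP u)) (set_mem (valP v)).
    exists w; rewrite [LHS]alexander_opE vw.
    by rewrite addrAC subrr add0r scalerA -exprS.
by rewrite fxy.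
Qed.

Lemma scaled_coset_closed (M : lmodType laurent) s (x : M) :
  qclosed (X := alexander_quandle M) (scaled_coset M s x).
Proof.
move=> _ _ /set_mem[u ->] /set_mem[v ->]; apply/mem_set.
by exists (alexander_op u v); exact: alexander_op_affine.
Qed.

Lemma scaled_coset_is_quandle (M : lmodType laurent) s (x : M) :
  is_quandle (sub_qop (@scaled_coset_closed M s x)).
Proof.
have [_ opI _ opD] := alexander_is_quandle M.
split.
- exact: (inhabits (exist _ x (mem_set (scaled_coset_refl M s x)))).
- by move=> u; apply: val_inj; exact: opI.
- move=> v; rewrite -setTT_bijective; split=> //.
    move=> u u' _ _ /(congr1 val) uu'; apply: val_inj.
    exact: alexander_op_inj uu'.
  move=> u _; have [w uE] := set_mem (valP u); have [w' vE] := set_mem (valP v).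
  (* The preimage is computed on the coordinates [w], [w'] and carried back by the affine map, so
     that it visibly lies in the coset. *)
  pose z := x + s *: (laurent_tV *: (w - (1 - laurent_t) *: w')).
  have zx : scaled_coset M s x z by eexists.
  exists (exist _ z (mem_set zx)) => //; apply: val_inj => /=.
  by rewrite vE alexander_op_affine alexander_opK.
- by move=> u v w; apply: val_inj; exact: opD.
Qed.

Definition coset_subquandle (M : lmodType laurent) s (x : M) :
    subquandle (alexander_quandle M) :=
  SubQuandle (scaled_coset_is_quandle M s x).

(** One translation suffices: [u] goes to [v] under translation by [u + s w'], where
    [(1 - t) s w' = v - u]. *)
Lemma coset_subquandle_connected (M : lmodType laurent) s (x : M) :
    (forall w : M, exists w', s *: w = (1 - laurent_t) *: (s *: w')) ->
  connected_subquandle (coset_subquandle M s x).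
Proof.
move=> sdiv u v.
have [w vE] : scaled_coset M s (val u) (val v).
  apply: scaled_coset_trans (set_mem (valP v)).
  exact/scaled_coset_sym/(set_mem (valP u)).
have [w' ww'] := sdiv w.
have zx : scaled_coset M s x (val u + s *: w').
  by apply: scaled_coset_trans (set_mem (valP u)) _; exists w'.
exists (fun y => @qop (quandle_of_sub (coset_subquandle M s x)) y
                   (exist _ (val u + s *: w') (mem_set zx))).
  exact: inner_translation.
apply: val_inj; rewrite /= alexander_opE vE ww'.
by rewrite addrAC subrr add0r.
Qed.

(** The hypotheses say that [1 - t] is surjective on [s M], which makes cosets connected, and that
    [(1 - t)^k M] lies in [s M], which confines every connected subquandle to one coset. *)
Lemma max_connected_setsE (M : lmodType laurent) s (k : nat) :
    (forall w : M, exists w', s *: w = (1 - laurent_t) *: (s *: w')) ->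
    (forall w : M, exists w', (1 - laurent_t) ^+ k *: w = s *: w') ->
  max_connected_sets (alexander_quandle M) = range (scaled_coset M s).
Proof.
move=> sdiv tdiv.
have sub_coset (A : subquandle (alexander_quandle M)) x :
    connected_subquandle A -> subquandle_set A x -> A `<=` scaled_coset M s x.
  move=> connA Ax y Ay; have [w ->] := connected_sub_coset M A k x y connA Ax Ay.
  by have [w' ->] := tdiv w; exists w'.
apply/seteqP; split=> [_ [A [connA maxA] ->]|_ [x _ <-]].
  have [[x] _ _ _] := subquandleP A.
  have Ax := set_mem (valP x); exists (val x) => //.
  apply: (maxA (coset_subquandle M s (val x))); last exact: sub_coset.
  exact: coset_subquandle_connected.
exists (coset_subquandle M s x) => //; split.
  exact: coset_subquandle_connected.
move=> B connB xB; apply/seteqP; split=> //; apply: sub_coset => //.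
exact/xB/scaled_coset_refl.
Qed.

(** * Laurent polynomials and integers modulo [(N, t + a)] *)

Definition ideal2_pi (R : comNzRingType) (x y r : R) : ideal2_quot x y :=
  \pi_(Quotient.quot (ideal2 x y))%qT r.

Lemma ideal2_pi_eq (R : comNzRingType) (x y r r' : R) :
  ideal2_pi R x y r = ideal2_pi R x y r' <->
  exists u v : R, r - r' = u * x + v * y.
Proof.
split=> [rr'|/ideal2P].
  by apply/ideal2P; rewrite Quotient.idealrBE; apply/eqP.
by rewrite Quotient.idealrBE => /eqP.
Qed.

Lemma ideal2_pi_surj (R : comNzRingType) (x y : R) (q : ideal2_quot x y) :
  exists r, q = ideal2_pi R x y r.
Proof. by exists (repr (q : Quotient.quot (ideal2 x y))); rewrite /ideal2_pi reprK. Qed.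

Lemma ideal2_piD (R : comNzRingType) (x y r r' : R) :
  ideal2_pi R x y (r + r') = ideal2_pi R x y r + ideal2_pi R x y r'.
Proof. exact: (raddfD (\pi_(Quotient.quot (ideal2 x y)))%qT r r'). Qed.

Lemma ideal2_piZ (R : comNzRingType) (x y c r : R) :
  ideal2_pi R x y (c * r) = c *: ideal2_pi R x y r.
Proof. by rewrite [RHS]ideal2_scale_pi. Qed.

(** The inclusion of [Z[t]], written as evaluation at [t] so that polynomial identities can be
    specialised. *)
Definition laurent_of_poly (p : {poly int}) : laurent :=
  (map_poly intr p).[laurent_t].

Lemma val_laurent_of_poly (p : {poly int}) :
  val (laurent_of_poly p) = FracField.tofrac p.
Proof.
rewrite /laurent_of_poly; elim/poly_ind: p => [|p c IH].
  by rewrite rmorph0 horner0 !rmorph0.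
rewrite rmorphD rmorphM /= map_polyX map_polyC /= hornerMXaddC.
have -> : c%:P = c%:~R :> {poly int} by rewrite -{1}(intz c) rmorph_int.
rewrite !rmorphD !rmorphM /= IH !rmorph_int.
by congr (_ + _); exact: (rmorph_int (val : laurent -> _)).
Qed.

Lemma laurent_of_polyE (f : laurent) :
  exists p k, f * laurent_t ^+ k = laurent_of_poly p.
Proof.
have /laurent_predP[p [k fE]] := laurent_valP f; exists p, k; apply: val_inj.
rewrite val_laurent_of_poly rmorphM rmorphXn /= fE.
by rewrite divfK // expf_neq0 // tofracX_neq0.
Qed.

Lemma laurent_of_poly_inj : injective laurent_of_poly.
Proof.
move=> p q /(congr1 val); rewrite !val_laurent_of_poly => /eqP.
by rewrite tofrac_eq => /eqP.
Qed.

Lemma sub_horner_factor (R : comNzRingType) (p : {poly R}) (x y : R) :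
  exists q, p.[x] - p.[y] = q * (x - y).
Proof.
elim/poly_ind: p => [|p c [q IH]]; first by exists 0; rewrite !horner0 subrr mul0r.
exists (q * x + p.[y]).
rewrite !hornerMXaddC.
have -> : p.[x] = q * (x - y) + p.[y] by rewrite -IH subrK.
ring.
Qed.

Lemma laurent_of_poly_mod (p : {poly int}) (a : int) :
  exists q, laurent_of_poly p = (p.[- a])%:~R + q * (laurent_t + a%:~R).
Proof.
have [q] := sub_horner_factor laurent (map_poly intr p) laurent_t (- a)%:~R.
rewrite horner_map rmorphN /= opprK => pE; exists q.
by rewrite -pE addrC subrK.
Qed.

(** Modulo [t + a], the polynomial [f t^k] becomes [p(-a)] and [t^k] becomes [(-a)^k], which is
    invertible modulo [N]. *)
Lemma laurent_mod_int (N a : int) (f : laurent) : coprimez N a ->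
  exists (c : int) (u v : laurent),
    f - c%:~R = u * N%:~R + v * (laurent_t + a%:~R).
Proof.
move=> copNa; have [p [k fE]] := laurent_of_polyE f.
have [q pE] := laurent_of_poly_mod p a.
have [q' XE] := laurent_of_poly_mod 'X^k a.
move: XE; rewrite /laurent_of_poly rmorphXn /= map_polyX !hornerXn => XE.
have /coprimezP[[v u] /= uv] : coprimez N ((- a) ^+ k).
  by rewrite coprimezXr // coprimezN.
(* Here [u] inverts [(-a)^k] modulo [N]; the other witnesses come from expanding
   [f = f (v N + u (-a)^k)]. *)
exists (u * p.[- a]), (f * v%:~R), (u%:~R * (q - f * q')).
have {uv} : (v * N + u * (- a) ^+ k)%:~R = 1 :> laurent by rewrite uv.
rewrite !rmorphD !rmorphM /= => uv.
have {}XE : ((- a) ^+ k)%:~R = laurent_t ^+ k - q' * (laurent_t + a%:~R).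
  by rewrite XE addrK.
have {}pE : (p.[- a])%:~R = f * laurent_t ^+ k - q * (laurent_t + a%:~R).
  by rewrite fE pE addrK.
rewrite pE -[f in X in X - _]mulr1 -[X in f * X]uv XE.
ring.
Qed.

(** Clearing denominators gives an identity in [Z[t]]; evaluating it at [-a] kills [t + a], so [N]
    divides [c (-a)^(k+m)], whose second factor is coprime to [N]. *)
Lemma int_in_laurent_ideal (N a c : int) (u v : laurent) : coprimez N a ->
  c%:~R = u * N%:~R + v * (laurent_t + a%:~R) -> (N %| c)%Z.
Proof.
move=> copNa cE.
have [U [k UE]] := laurent_of_polyE u; have [V [m VE]] := laurent_of_polyE v.
have : laurent_of_poly (c%:P * 'X^(k + m)) =
       laurent_of_poly (U * 'X^m * N%:P + V * 'X^k * ('X + a%:P)).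
  rewrite /laurent_of_poly !(rmorphD, rmorphM) /= !map_polyC !map_polyXn map_polyX /=.
  rewrite !(hornerM, hornerD, hornerC, hornerXn, hornerX).
  rewrite -/(laurent_of_poly U) -/(laurent_of_poly V) -UE -VE exprD cE.
  ring.
move/laurent_of_poly_inj/(congr1 (fun p => p.[- a])).
rewrite !(hornerM, hornerD, hornerC, hornerXn, hornerX) addNr mulr0 addr0 => cE'.
rewrite -(@Gauss_dvdzl _ _ ((- a) ^+ (k + m))); last first.
  by rewrite coprimezXr // coprimezN.
by rewrite cE' dvdz_mull.
Qed.

(** * The cosets of [N M]: maximality, number and isomorphism type *)

Lemma partition_scaled_coset (M : lmodType laurent) (s : laurent) :
  partition (range (scaled_coset M s)) id [set: M].
Proof.
split=> [|_ _ [x _ <-] [y _ <-] [z [xz yz]]|_ [x _ <-]].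
- apply/seteqP; split=> // x _; exists (scaled_coset M s x) => //.
  exact: scaled_coset_refl.
- by rewrite (scaled_coset_eq M s x z xz) (scaled_coset_eq M s y z yz).
- by exists x; exact: scaled_coset_refl.
Qed.

Lemma alexander_mod_max_connected_sets (N m : nat) (a : int) (k : nat) :
    coprimez m%:Z (1 + a) -> (N%:Z %| (1 + a) ^+ k)%Z ->
  max_connected_sets (alexander_mod (N * m) a) =
  range (scaled_coset (ideal2_quot ((N * m)%:R : laurent) (laurent_t + a%:~R))
           N%:R).
Proof.
move=> /coprimezP[[d c] /= dc] /dvdzP[e eE].
apply: (@max_connected_setsE _ _ k) => w.
  have [r ->] := ideal2_pi_surj _ _ _ w.
  (* The integer [c] inverts [1 + a] modulo [m], and [1 - t] acts as [1 + a]; the error [d m] is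
     killed after multiplication by [N]. *)
  exists (ideal2_pi _ _ _ (c%:~R * r)).
  rewrite -[N%:R *: ideal2_pi _ _ _ (c%:~R * r)]ideal2_piZ -!ideal2_piZ.
  apply/ideal2_pi_eq; exists (d%:~R * r), (N%:R * r * c%:~R).
  have {}dc : d%:~R * m%:R = 1 - c%:~R * (1 + a%:~R) :> laurent.
    have : (d * m + c * (1 + a))%:~R = 1 :> laurent by rewrite dc.
    by rewrite !(rmorphD, rmorphM) /= => dcE; rewrite -[X in _ = X - _]dcE addrK.
  transitivity (N%:R * r * (d%:~R * m%:R) +
                N%:R * r * c%:~R * (laurent_t + a%:~R)); first by rewrite dc; ring.
  by rewrite natrM; ring.
have [r ->] := ideal2_pi_surj _ _ _ w.
exists (ideal2_pi _ _ _ (e%:~R * r)); rewrite -!ideal2_piZ.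
(* [(1 - t)^k] and [(1 + a)^k = e N] agree modulo [t + a]. *)
have [q] := sub_horner_factor laurent 'X^k (1 - laurent_t) (1 + a%:~R).
have -> : 1 - laurent_t - (1 + a%:~R) = - (laurent_t + a%:~R) by ring.
rewrite !hornerXn => qE; apply/ideal2_pi_eq; exists 0, (- (q * r)).
have {}eE : (1 + a%:~R) ^+ k = e%:~R * N%:R :> laurent.
  by rewrite -[N%:R]/(N%:~R) -rmorphM -eE rmorphXn rmorphD.
have {qE}-> : (1 - laurent_t) ^+ k =
    e%:~R * N%:R + q * - (laurent_t + a%:~R) by rewrite -qE eE [RHS]addrC subrK.
ring.
Qed.

(** The quotient [M / N M] is [Z[t,1/t]/(N, t + a)], that is [Z/N]; the residues below [N] represent
    its classes. *)
Lemma card_scaled_cosets (N m : nat) (a : int) :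
    (0 < N)%N -> coprimez N%:Z a ->
  range (scaled_coset (ideal2_quot ((N * m)%:R : laurent) (laurent_t + a%:~R))
           N%:R) #= `I_N.
Proof.
move=> N_gt0 copNa.
set M := ideal2_quot _ _; pose p : laurent -> M := ideal2_pi _ _ _.
pose f (i : nat) := scaled_coset M N%:R (p i%:R).
have -> : range (scaled_coset M N%:R) = f @` `I_N.
  apply/seteqP; split=> [_ [x _ <-]|_ [i _ <-]]; last by exists (p i%:R).
  have [r ->] := ideal2_pi_surj _ _ _ x.
  have [c [u [v rc]]] := laurent_mod_int N%:Z a r copNa.
  have cE : (c %% N)%Z = `|(c %% N)%Z|%N by rewrite gez0_abs // modz_ge0 // -lt0n.
  exists `|(c %% N)%Z|%N.
    by rewrite /= -ltz_nat -cE ltz_pmod.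
  apply: scaled_coset_eq; exists (p ((c %/ N)%Z%:~R + u)).
  rewrite -ideal2_piZ -ideal2_piD; apply/ideal2_pi_eq; exists 0, v.
  have cNE : c%:~R = (c %/ N)%Z%:~R * N%:R + `|(c %% N)%Z|%N%:R :> laurent.
    by rewrite {1}(divz_eq c N) rmorphD rmorphM /= cE.
  have -> : r = c%:~R + u * N%:R + v * (laurent_t + a%:~R).
    by rewrite -addrA -rc addrC subrK.
  rewrite cNE; ring.
apply: inj_card_eq => i j /set_mem /= iN /set_mem /= jN fij.
have [w] : scaled_coset M N%:R (p j%:R) (p i%:R).
  by rewrite -/(f j) -fij; exact: scaled_coset_refl.
have [r ->] := ideal2_pi_surj _ _ _ w.
rewrite -ideal2_piZ -ideal2_piD => /ideal2_pi_eq[u [v ijE]].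
have : (N%:Z %| i%:Z - j%:Z)%Z.
  apply: (int_in_laurent_ideal N%:Z a _ (r + u * m%:R) v copNa).
  have -> : (i%:Z - j%:Z)%:~R = i%:R - j%:R :> laurent by rewrite rmorphB.
  have -> : i%:R - j%:R = i%:R - (j%:R + N%:R * r) + N%:R * r :> laurent by ring.
  rewrite ijE natrM -[N%:~R]/(N%:R); ring.
rewrite -eqz_mod_dvd !modz_nat => /eqP[].
by rewrite !modn_small.
Qed.

(** Multiplication by [N] is well defined and injective from the quotient by [(m, y)] to that by
    [(N m, y)]. For injectivity, [r - r'] is split by the Bezout relation [c N + d m = 1]. *)
Lemma ideal2_pi_mul (N m : nat) (y r r' : laurent) : coprimez N%:Z m%:Z ->
  ideal2_pi _ ((N * m)%:R) y (N%:R * r) = ideal2_pi _ ((N * m)%:R) y (N%:R * r') <->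
  ideal2_pi _ m%:R y r = ideal2_pi _ m%:R y r'.
Proof.
move=> /coprimezP[[c d] /= cd].
have {}cd : c%:~R * N%:R + d%:~R * m%:R = 1 :> laurent.
  have : (c * N + d * m)%:~R = 1 :> laurent by rewrite cd.
  by rewrite rmorphD !rmorphM.
split=> /ideal2_pi_eq[u [v uvE]]; apply/ideal2_pi_eq.
  exists (c%:~R * u * N%:R + d%:~R * (r - r')), (c%:~R * v).
  transitivity ((c%:~R * N%:R + d%:~R * m%:R) * (r - r')).
    by rewrite cd mul1r.
  transitivity (c%:~R * (N%:R * r - N%:R * r') + d%:~R * m%:R * (r - r')).
    by ring.
  by rewrite uvE natrM; ring.
by exists u, (N%:R * v); rewrite -mulrBr uvE natrM; ring.
Qed.

Lemma scaled_coset_iso (N m : nat) (a : int)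
    (A : subquandle (alexander_mod (N * m) a))
    (x : ideal2_quot ((N * m)%:R : laurent) (laurent_t + a%:~R)) :
    coprimez N%:Z m%:Z -> subquandle_set A = scaled_coset _ N%:R x ->
  quandle_iso (quandle_of_sub A) (alexander_mod m a).
Proof.
move=> copNm Ax.
pose p r := ideal2_pi laurent (N * m)%:R (laurent_t + a%:~R) r.
pose p' r : alexander_mod m a := ideal2_pi laurent m%:R (laurent_t + a%:~R) r.
have Ap r : subquandle_set A (x + p (N%:R * r)).
  by rewrite Ax; exists (p r); rewrite -ideal2_piZ.
(* [f] sends [x + N r] to the class of [r] modulo [(m, t + a)]; [pE] below shows that the choice of
   [r] does not matter. *)
have /choice[f fP] : forall y : quandle_of_sub A, exists q, exists r,
    q = p' r /\ val y = x + p (N%:R * r).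
  move=> y; have [w yE] : scaled_coset _ N%:R x (val y).
    by rewrite -Ax; exact: set_mem (valP y).
  have [r wE] := ideal2_pi_surj _ _ _ w.
  by exists (p' r), r; split=> //; rewrite yE wE -ideal2_piZ.
have pE r r' : x + p (N%:R * r) = x + p (N%:R * r') <-> p' r = p' r'.
  split=> [/addrI|] rr'; first exact/(ideal2_pi_mul N).
  by congr (_ + _); exact/ideal2_pi_mul.
exists f.
  rewrite -setTT_bijective; split=> // [y y' _ _|q _].
    have [r [-> yE]] := fP y; have [r' [-> y'E]] := fP y' => rr'.
    by apply: val_inj; rewrite yE y'E; apply/pE.
  have [r ->] := ideal2_pi_surj _ _ _ q.
  pose y : quandle_of_sub A :=
    exist (fun y => y \in subquandle_set A) _ (mem_set (Ap r)).
  by exists y => //; have [r' [-> /= /pE]] := fP y.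
move=> y y'.
have [r'' [-> yy'E]] := fP (qop y y').
have [r [-> yE]] := fP y; have [r' [-> y'E]] := fP y'.
transitivity (p' (laurent_t * r + (1 - laurent_t) * r')).
  apply/pE; rewrite -yy'E /= yE y'E /p !ideal2_piZ.
  by rewrite [LHS]alexander_op_affine ideal2_piD !ideal2_piZ.
by rewrite /p' ideal2_piD !ideal2_piZ.
Qed.

(** * Arithmetic of the gcd sequence and conclusion *)

Lemma gcd_quotients_prod (n : nat -> nat) (b : nat)
    (nS : forall i, n i.+1 = (n i %/ gcdn (n i) b)%N) (k : nat) :
  n 0%N = (\prod_(i < k) gcdn (n i) b * n k)%N.
Proof.
elim: k => [|k ->]; first by rewrite big_ord0 mul1n.
by rewrite big_ord_recr /= -mulnA nS [(gcdn _ _ * _)%N]mulnC divnK ?dvdn_gcdl.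
Qed.

Lemma prod_gcd_dvd_exp (n : nat -> nat) (b k : nat) :
  (\prod_(i < k) gcdn (n i) b %| b ^ k)%N.
Proof.
elim: k => [|k IH]; first by rewrite big_ord0.
by rewrite big_ord_recr expnSr dvdn_mul ?dvdn_gcdr.
Qed.

Theorem proposition1 (n : nat -> nat) (a : int) (l : nat)
  (n0_gt0 : (0 < n 0)%N)
  (nS : forall i, n i.+1 = (n i %/ gcdn (n i) `|(1 + a)%R|)%N)
  (n_l : n l = n l.+1)
  (l_min : forall k, n k = n k.+1 -> (l <= k)%N) :
  let X := alexander_mod (n 0%N) a in
  [/\ max_connected_decomposition (max_connected_sets X),
      max_connected_sets X #= `I_(\prod_(i < l) gcdn (n i) `|(1 + a)%R|)%N
    & forall A : subquandle X, max_connected_subquandle A ->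
        quandle_iso (quandle_of_sub A) (alexander_mod (n l) a)].
Proof.
move=> X; set b := `|(1 + a)%R|%N; pose N := (\prod_(i < l) gcdn (n i) b)%N.
have n0E : n 0%N = (N * n l)%N := gcd_quotients_prod n b nS l.
have [N_gt0 nl_gt0] : (0 < N)%N /\ (0 < n l)%N.
  by apply/andP; rewrite -muln_gt0 -n0E.
(* Stationarity at [l] gives [n_l gcd(n_l, b) = n_l], and the positive [n_l] cancels. *)
have copnlb : coprimez (n l)%:Z (1 + a).
  have := divnK (dvdn_gcdl (n l) b); rewrite -nS -n_l => /eqP.
  by rewrite -[X in _ == X]muln1 eqn_pmul2l.
have Nb : (N%:Z %| (1 + a) ^+ l)%Z.
  by rewrite dvdzE abszX; exact: prod_gcd_dvd_exp.
(* [N] divides a power of [1 + a], so it inherits coprimality: to [a], as [(1 + a) - a = 1], and to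
   [n_l]. *)
have copN c : coprimez (1 + a) c -> coprimez N%:Z c.
  by move=> bc; apply: coprimez_dvdl Nb _; exact: coprimezXl.
have copNa : coprimez N%:Z a.
  by apply/copN/coprimezP; exists (1, -1); rewrite /= mul1r mulN1r addrK.
have copNnl : coprimez N%:Z (n l)%:Z.
  by apply: copN; rewrite coprimez_sym.
rewrite /X n0E.
have maxE := alexander_mod_max_connected_sets N (n l) a l copnlb Nb.
split.
- by split=> //; rewrite maxE; exact: partition_scaled_coset.
- by rewrite maxE; exact: card_scaled_cosets.
- move=> A maxA.
  have : max_connected_sets _ (subquandle_set A) by exists A.
  by rewrite maxE => -[x _ Ax]; apply: (scaled_coset_iso N (n l) a A x).
Qed.
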